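(* Let $s$ and $t$ be relatively prime positive integers, and let $X$ denote the size of a partition chosen uniformly at random from the (finite, nonempty) set of $(s,t)$-core partitions. Then the variance of $X$ is $$\mathbf{E}\big[(X-\mathbf{E}[X])^2\big]=\frac{1}{1440}\, s\,t\,(t-1)(s-1)(s+t+1)(s+t).$$
   Context: A partition is a non-increasing finite sequence of positive integers $\lambda=(\lambda_1,\dots,\lambda_k)$, $k\ge 0$ (the empty partition is allowed); its size is $\lambda_1+\dots+\lambda_k$. Its Ferrers diagram consists of the cells $(i,j)$ with $1\le i\le k$, $1\le j\le\lambda_i$. The hook length of cell $(i,j)$ is $\lambda_i-j+\lambda'_j-i+1$, where $\lambda'$ is the conjugate partition ($\lambda'_j$ = number of $i$ with $\lambda_i\ge j$). A partition is an $s$-core if no cell has hook length equal to $s$, and an $(s,t)$-core partition if it is simultaneously an $s$-core and a $t$-core. For coprime $s,t$ the set of $(s,t)$-core partitions is finite, and it is given the uniform probability distribution. *)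

(* Defs.v *)
From mathcomp Require Export all_boot all_order all_algebra finmap.

Set Implicit Arguments.
Unset Strict Implicit.
Unset Printing Implicit Defensive.

Import GRing.Theory.

Definition is_partition (l : seq nat) : bool := sorted geq l && all (ltn 0) l.

(* Parts, columns and cells are numbered from 1. *)
Definition part (l : seq nat) (i : nat) : nat := nth 0 l i.-1.

Definition conj_part (l : seq nat) (j : nat) : nat :=
  count (fun a => j <= a) l.

Definition is_cell (l : seq nat) (i j : nat) : bool :=
  (1 <= i <= size l) && (1 <= j <= part l i).

(* Neither natural-number subtraction truncates at a cell of a partition. *)
Definition hook_length (l : seq nat) (i j : nat) : nat :=
  (part l i - j) + (conj_part l j - i) + 1.

Definition is_core (s : nat) (l : seq nat) : Prop :=
  forall i j, is_cell l i j -> hook_length l i j <> s.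

Definition st_core_partition (s t : nat) (l : seq nat) : Prop :=
  [/\ is_partition l, is_core s l & is_core t l].

Definition partition_size (l : seq nat) : nat := sumn l.

Local Open Scope ring_scope.

Definition unif_expectation (T : choiceType) (C : {fset T}) (X : T -> rat) : rat :=
  (\sum_(x <- C) X x) / (#|` C|)%:R.

Definition unif_variance (T : choiceType) (C : {fset T}) (X : T -> rat) : rat :=
  unif_expectation C (fun x => (X x - unif_expectation C X) ^+ 2).

(* Main.v *)
(* Let N = s + t.  The first-column hooks of an (s,t)-core form a finite set B
   of positive integers stable under b |-> b - s and b |-> b - t.  Let x_p be the
   least natural number outside B with N | x_p + s p.  Then x_(p+1) is x_p + t
   or x_p - s, so the core is encoded by the s-subset P of Z/N of the up-steps,
   and the closed walk x stays nonnegative.  The size of the core is, up to a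
   constant, half the variance of x over one period, namely
     (s^2 - 1)(N^2 - 1)/24 - (1/4) sum_(i, j in P) d (N - d),  d = i - j mod N.
   This expression is invariant under rotation of P, and by the cycle lemma each
   s-subset has exactly one nonnegative rotation among its N rotations.  Hence
   the size of a random core is distributed as this quadratic function of a
   uniformly random s-subset of Z/N, whose second moment only involves the
   probabilities that 2, 3 or 4 given points lie in P. *)
Require Import Defs.
From mathcomp Require Import zify ring.
Import GRing.Theory Num.Theory.

Set Implicit Arguments.
Unset Strict Implicit.
Unset Printing Implicit Defensive.

(** * First-column hooks and cores *)

Fixpoint first_column_hooks (l : seq nat) : seq nat :=
  if l is a :: l' then a + size l' :: first_column_hooks l' else [::].

Fixpoint hooks_to_partition (B : seq nat) : seq nat :=
  if B is b :: B' then b - size B' :: hooks_to_partition B' else [::].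

Lemma size_first_column_hooks (l : seq nat) :
  size (first_column_hooks l) = size l.
Proof. by elim: l => //= a l ->. Qed.

Lemma size_hooks_to_partition (B : seq nat) :
  size (hooks_to_partition B) = size B.
Proof. by elim: B => //= b B ->. Qed.

Lemma first_column_hooksK : cancel first_column_hooks hooks_to_partition.
Proof. by elim=> //= a l ->; rewrite size_first_column_hooks addnK. Qed.

Lemma sorted_geq_cons (a : nat) (l : seq nat) :
  sorted geq (a :: l) -> sorted geq l /\ {in l, forall b, b <= a}.
Proof.
rewrite /= (path_sortedE (rev_trans leq_trans)) => /andP[/allP a_ge ->].
by split=> // b /a_ge.
Qed.

Lemma sorted_gtn_cons (b : nat) (B : seq nat) :
  sorted gtn (b :: B) = sorted gtn B && all (gtn b) B.
Proof. by rewrite /= (path_sortedE (rev_trans ltn_trans)) andbC. Qed.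

Lemma first_column_hooks_lt (a : nat) (l : seq nat) :
  sorted geq (a :: l) -> {in first_column_hooks l, forall b, b < a + size l}.
Proof.
elim: l a => //= a' l IH a /andP[le_a'a sorted_l] b.
by rewrite inE => /orP[/eqP->|/(IH a' sorted_l)]; lia.
Qed.

Lemma first_column_hooks_sorted (l : seq nat) :
  sorted geq l -> sorted gtn (first_column_hooks l).
Proof.
elim: l => // a l IH sorted_al; have [sorted_l _] := sorted_geq_cons sorted_al.
rewrite [first_column_hooks _]/= sorted_gtn_cons IH //=.
by apply/allP => b /(first_column_hooks_lt sorted_al).
Qed.

Lemma first_column_hooks_gt0 (l : seq nat) :
  all (ltn 0) l -> all (ltn 0) (first_column_hooks l).
Proof. by elim: l => //= a l IH /andP[a_gt0 /IH ->]; rewrite andbT; lia. Qed.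

Lemma sorted_gtn_size (b : nat) (B : seq nat) :
  sorted gtn (b :: B) -> size B <= b.
Proof.
elim: B b => // c B IH b.
rewrite sorted_gtn_cons => /andP[/IH le_size_c /andP[/= c_lt_b _]].
by apply: leq_ltn_trans c_lt_b.
Qed.

Lemma sorted_gtn_size_gt0 (b : nat) (B : seq nat) :
  sorted gtn (b :: B) -> all (ltn 0) (b :: B) -> size B < b.
Proof.
elim: B b => [|c B IH] b; first by move=> _ /andP[].
rewrite sorted_gtn_cons => /andP[/IH lt_size_c /andP[/= c_lt_b _]].
by move=> /andP[_ /lt_size_c/leq_ltn_trans]; apply.
Qed.

Lemma hooks_to_partitionK (B : seq nat) :
  sorted gtn B -> first_column_hooks (hooks_to_partition B) = B.
Proof.
elim: B => // b B IH sorted_bB.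
have := sorted_bB; rewrite sorted_gtn_cons => /andP[sorted_B _].
by rewrite /= IH // size_hooks_to_partition subnK // sorted_gtn_size.
Qed.

Lemma hooks_to_partition_is_partition (B : seq nat) :
  sorted gtn B -> all (ltn 0) B -> is_partition (hooks_to_partition B).
Proof.
rewrite /is_partition; elim: B => // b B IH sorted_bB pos_bB.
have := sorted_bB; rewrite sorted_gtn_cons => /andP[sorted_B B_lt_b].
have /andP[_ pos_B] := pos_bB.
have /andP[sorted_l pos_l] := IH sorted_B pos_B.
have lt_size_b := sorted_gtn_size_gt0 sorted_bB pos_bB.
rewrite /= subn_gt0 lt_size_b pos_l /= andbT.
case: B B_lt_b sorted_l {lt_size_b pos_B pos_bB sorted_B sorted_bB pos_l IH} => //=.
by move=> c B /andP[c_lt_b _] sorted_l; rewrite /= sorted_l andbT; lia.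
Qed.

Lemma sumn_first_column_hooks (l : seq nat) :
  sumn (first_column_hooks l) = sumn l + 'C(size l, 2).
Proof. by elim: l => //= a l ->; rewrite binS bin1; lia. Qed.

Lemma conj_part_cons (a : nat) (l : seq nat) (j : nat) :
  conj_part (a :: l) j = (j <= a) + conj_part l j.
Proof. by []. Qed.

Lemma conj_part_eq0 (a : nat) (l : seq nat) (j : nat) :
  {in l, forall b, b <= a} -> a < j -> conj_part l j = 0.
Proof.
move=> l_le_a a_lt_j; apply/eqP; rewrite -leqn0 leqNgt -has_count.
by apply/hasPn => b /l_le_a; lia.
Qed.

Lemma conj_part_le_size (l : seq nat) (j : nat) : conj_part l j <= size l.
Proof. exact: count_size. Qed.

(* The column [j] of a partition inside a strip of width [a] contributes the
   non-hook [j - 1 + size l - conj_part l j]. *)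
Lemma notin_first_column_hooks (a : nat) (l : seq nat) (h : nat) :
  sorted geq (a :: l) -> h < a + size l ->
  reflect (exists2 j, 1 <= j <= a & h + conj_part l j = j.-1 + size l)
          (h \notin first_column_hooks l).
Proof.
elim: l a => [|b l IH] a sorted_al h_lt.
  apply: (iffP idP) => // _.
  by exists h.+1; rewrite // /conj_part /= in h_lt *; lia.
have [sorted_bl /(_ b (mem_head _ _)) b_le_a] := sorted_geq_cons sorted_al.
have conj_part0 j := @conj_part_eq0 b l j (sorted_geq_cons sorted_bl).2.
rewrite [size _]/= in h_lt *; rewrite [first_column_hooks _]/= inE negb_or.
case: (ltngtP h (b + size l)) => h_b; rewrite ?andTb ?andFb.
- apply: (iffP (IH b sorted_bl h_b)) => -[j j_bounds j_eq].
    by exists j; [lia | rewrite conj_part_cons; lia].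
  move: j_eq; rewrite conj_part_cons.
  by case: (leqP j b) => [|/[dup] ? /conj_part0 ->] j_eq; [exists j | exfalso]; lia.
- apply: (iffP idP) => [_|_]; last first.
    by apply/negP => /(first_column_hooks_lt sorted_bl); lia.
  by exists (h - size l); rewrite ?conj_part_cons ?conj_part0; lia.
- constructor=> -[j j_bounds]; rewrite conj_part_cons.
  by have [j_le_b|/[dup] ? /conj_part0 ->] := leqP j b; lia.
Qed.

Lemma mem_part (l : seq nat) (i : nat) : 1 <= i <= size l -> part l i \in l.
Proof. by case: i => // i i_lt; apply: mem_nth. Qed.

Lemma is_core_cons (s a : nat) (l : seq nat) : sorted geq (a :: l) ->
  is_core s (a :: l) <->
  is_core s l /\ forall j, 1 <= j <= a -> a - j + conj_part l j + 1 <> s.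
Proof.
move=> /sorted_geq_cons[_ l_le_a].
have part_cons i : part (a :: l) i.+2 = part l i.+1 by [].
have part_le i : 0 < i.+1 <= size l -> part l i.+1 <= a by move=> /mem_part/l_le_a.
split=> [core_al|[core_l first_row] [|[|i]] j]; rewrite ?/is_cell ?/hook_length //.
- split=> [[|i] j|j j_le hook_eq]; rewrite /is_cell /hook_length //.
    case/andP=> /[dup] i_le /part_le le_a j_le hook_eq.
    apply: (core_al i.+2 j); rewrite /is_cell /hook_length part_cons.
      by rewrite j_le andbT; move: i_le.
    by rewrite conj_part_cons; lia.
  apply: (core_al 1 j); first by rewrite /is_cell /part /= j_le.
  by rewrite /hook_length conj_part_cons /part [nth _ _ _]/=; lia.
- rewrite conj_part_cons /part [nth _ _ _]/= => /andP[_ j_le].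
  by have := first_row j j_le; lia.
- rewrite part_cons conj_part_cons => /andP[i_le j_le].
  have cell : is_cell l i.+1 j by rewrite /is_cell j_le andbT; move: i_le.
  by have := core_l _ _ cell; have := part_le i i_le; rewrite /hook_length; lia.
Qed.

Definition sub_stable (m : nat) (B : seq nat) : Prop :=
  {in B, forall b, m <= b -> b - m \in B}.

Lemma is_core_sub_stable (s : nat) (l : seq nat) : 0 < s -> sorted geq l ->
  is_core s l <-> sub_stable s (first_column_hooks l).
Proof.
move=> s_gt0; elim: l => [|a l IH] sorted_al; first by split=> // _ [|i] j.
have [sorted_l _] := sorted_geq_cons sorted_al.
rewrite (is_core_cons s sorted_al) (IH sorted_l) /=; split.
- case=> stable_l first_row b; rewrite !inE => /orP[/eqP->|b_in] s_le; last first.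
    by rewrite stable_l // orbT.
  apply/orP; right; apply: contraT => /(notin_first_column_hooks sorted_al).
  by case=> [|j /[dup] j_le /first_row hook_neq]; lia.
- move=> stable_al; split=> [b b_in s_le|j j_le hook_eq].
    have := stable_al b; rewrite !inE b_in orbT => /(_ isT s_le) /orP[/eqP|//].
    by have := first_column_hooks_lt sorted_al b_in; lia.
  have conj_le := conj_part_le_size l j.
  have notin : a + size l - s \notin first_column_hooks l.
    by apply/(notin_first_column_hooks sorted_al); [|exists j => //]; lia.
  have := stable_al (a + size l); rewrite !inE eqxx (negPf notin) orbF.
  by move=> /(_ isT) /implyP; apply/negP; rewrite negb_imply; lia.
Qed.

(** * Cores as nonnegative closed walks *)

Section CyclicWalk.

Variables (s n : nat).

Implicit Types (P Q : {set 'I_n.+1}) (b p q : nat).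

Definition ups P p := \sum_(0 <= q < p) (inZp q \in P).

(* The subtraction does not truncate when [P] is in [dyck_subsets]. *)
Definition level P p := n.+1 * ups P p - s * p.

Definition dyck_subsets : {set {set 'I_n.+1}} :=
  [set P : {set 'I_n.+1} |
    (#|P| == s) && [forall p : 'I_n.+1, s * p <= n.+1 * ups P p]].

Definition gaps P :=
  rev [seq b <- iota 0 (n.+1 * n.+1)
    | [exists p : 'I_n.+1, (b < level P p) && (n.+1 %| b + s * p)]].

Definition core_of P := hooks_to_partition (gaps P).

Lemma ups0 P : ups P 0 = 0.
Proof. by rewrite /ups big_geq. Qed.

Lemma upsS P p : ups P p.+1 = ups P p + (inZp p \in P).
Proof. by rewrite /ups big_nat_recr. Qed.

Lemma ups_le P p : ups P p <= p.
Proof.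
elim: p => [|p IH]; first by rewrite ups0.
by rewrite upsS; have := leq_b1 (inZp p \in P); lia.
Qed.

Lemma ups_period P : ups P n.+1 = #|P|.
Proof.
rewrite /ups big_mkord -sum1_card [RHS]big_mkcond /=.
by apply: eq_bigr => i _; rewrite valZpK; case: (i \in P).
Qed.

Lemma ups_add_period P p : ups P (p + n.+1) = ups P p + #|P|.
Proof.
elim: p => [|p IH]; first by rewrite ups_period ups0.
rewrite addSn !upsS IH addnAC; congr (_ + (_ \in P) + _).
by apply/val_inj; rewrite /= modnDr.
Qed.

Lemma ups_add_periods P p k : ups P (p + k * n.+1) = ups P p + k * #|P|.
Proof.
elim: k => [|k IH]; first by rewrite !mul0n !addn0.
by rewrite mulSn [n.+1 + _]addnC addnA ups_add_period IH mulSn addnAC addnA.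
Qed.

Lemma level0 P : level P 0 = 0.
Proof. by rewrite /level ups0 muln0. Qed.

Lemma level_le P p : level P p <= n.+1 * p.
Proof. by rewrite (leq_trans (leq_subr _ _)) // leq_mul2l ups_le orbT. Qed.

Lemma level_mod P p : #|P| = s -> level P (p %% n.+1) = level P p.
Proof.
move=> card_P; rewrite /level [in RHS](divn_eq p n.+1) addnC ups_add_periods card_P.
by rewrite !mulnDr [s * (_ * _)]mulnC -mulnA mulnCA subnDr.
Qed.

Lemma dyck_subsetsP P :
  reflect (#|P| = s /\ forall p, s * p <= n.+1 * ups P p) (P \in dyck_subsets).
Proof.
rewrite inE; apply: (iffP andP) => -[/eqP card_P nonneg]; split=> //.
  move=> p; have := forallP nonneg (inZp p).
  rewrite [in X in _ -> X](divn_eq p n.+1) addnC ups_add_periods card_P /=.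
  by rewrite !mulnDr [s * (_ * _)]mulnC -mulnA mulnCA leq_add2r.
by apply/forallP=> p; apply: nonneg.
Qed.

Lemma gaps_sorted P : sorted gtn (gaps P).
Proof.
rewrite /gaps rev_sorted; apply: sorted_filter; first exact: ltn_trans.
exact: iota_ltn_sorted.
Qed.

Hypothesis coprime_s_n : coprime s n.+1.

Lemma eq_modn_coprimeMl p q : s * p = s * q %[mod n.+1] -> p = q %[mod n.+1].
Proof.
wlog le_qp : p q / q <= p => [ordered|].
  by have [/ordered//|/ltnW/ordered swapped] := leqP q p; move=> /esym/swapped/esym.
move=> /eqP; rewrite !eqn_mod_dvd ?leq_mul2l ?le_qp ?orbT // -mulnBr.
by rewrite Gauss_dvdr 1?coprime_sym // -eqn_mod_dvd // => /eqP.
Qed.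

Lemma eq_modn_index b c p q : b = c %[mod n.+1] ->
  n.+1 %| b + s * p -> n.+1 %| c + s * q -> p = q %[mod n.+1].
Proof.
move=> eq_bc; rewrite /dvdn -modnDml eq_bc modnDml => /eqP dvd_p /eqP dvd_q.
by apply/eq_modn_coprimeMl/eqP; rewrite -(eqn_modDl c) dvd_p dvd_q.
Qed.

Lemma eq_ord_index b c (i j : 'I_n.+1) : b = c %[mod n.+1] ->
  n.+1 %| b + s * i -> n.+1 %| c + s * j -> i = j.
Proof.
move=> eq_bc index_i index_j; apply/val_inj => /=.
by have := eq_modn_index eq_bc index_i index_j; rewrite !modn_small.
Qed.

Lemma exists_index b : exists p : 'I_n.+1, n.+1 %| b + s * p.
Proof.
have inj : injective (fun p : 'I_n.+1 => inZp (b + s * p) : 'I_n.+1).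
  move=> p q /(congr1 val)/eqP; rewrite /= eqn_modDl => /eqP/eq_modn_coprimeMl.
  by rewrite !modn_small // => /val_inj.
have /codomP[p /(congr1 val) /= index_p] := injF_onto inj ord0.
by exists p; rewrite /dvdn -index_p.
Qed.

Section DyckSubset.

Variable P : {set 'I_n.+1}.
Hypothesis dyck_P : P \in dyck_subsets.

Lemma card_dyck : #|P| = s.
Proof. by case/dyck_subsetsP: dyck_P. Qed.

Lemma dyck_ups p : s * p <= n.+1 * ups P p.
Proof. by case/dyck_subsetsP: dyck_P. Qed.

Lemma levelK p : level P p + s * p = n.+1 * ups P p.
Proof. by rewrite subnK ?dyck_ups. Qed.

Lemma dvdn_level p : n.+1 %| level P p + s * p.
Proof. by rewrite levelK dvdn_mulr. Qed.

Lemma levelS p :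
  level P p.+1 + s = level P p + (if inZp p \in P then n.+1 else 0).
Proof. by have := levelK p; have := levelK p.+1; rewrite upsS; case: ifP; lia. Qed.

Lemma mem_gaps b p : n.+1 %| b + s * p -> (b \in gaps P) = (b < level P p).
Proof.
move=> index_p; rewrite mem_rev mem_filter mem_iota add0n /=; apply/andP/idP.
  case=> /existsP[q /andP[b_lt index_q]] _.
  have eq_pq := eq_modn_index (erefl (b %% n.+1)) index_p index_q.
  by rewrite -(level_mod p card_dyck) eq_pq level_mod // card_dyck.
rewrite -(level_mod p card_dyck) => b_lt; split.
  apply/existsP; exists (inZp p); rewrite /= b_lt.
  by rewrite /dvdn -modnDmr modnMmr modnDmr.
apply: leq_trans b_lt (leq_trans (level_le _ _) _).
by rewrite leq_mul2l /= ltnW // ltn_mod.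
Qed.

Lemma gaps_gt0 : all (ltn 0) (gaps P).
Proof.
apply/allP => -[|b] //; rewrite (@mem_gaps 0 0) ?muln0 //.
by rewrite level0.
Qed.

Lemma sub_stable_gaps_down : sub_stable s (gaps P).
Proof.
move=> b gap_b le_sb; have [p index_p] := exists_index b.
have index_pS : n.+1 %| b - s + s * p.+1 by rewrite mulnS addnA subnK.
move: gap_b; rewrite (mem_gaps index_p) (mem_gaps index_pS).
by have := levelS p; case: ifP; lia.
Qed.

Lemma sub_stable_gaps_up t : s + t = n.+1 -> sub_stable t (gaps P).
Proof.
move=> st_n b gap_b le_tb; have [p index_p] := exists_index (b - t).
have index_pS : n.+1 %| b + s * p.+1.
  have -> : b + s * p.+1 = b - t + s * p + n.+1 by rewrite mulnS; lia.
  by rewrite dvdn_addl.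
move: gap_b; rewrite (mem_gaps index_p) (mem_gaps index_pS).
by have := levelS p; case: ifP; lia.
Qed.

Lemma core_of_st_core t : 0 < s -> 0 < t -> s + t = n.+1 ->
  st_core_partition s t (core_of P).
Proof.
move=> s_gt0 t_gt0 st_n.
have part_P := hooks_to_partition_is_partition (gaps_sorted P) gaps_gt0.
have [sorted_P _] := andP part_P.
by split=> //; apply/is_core_sub_stable;
  rewrite ?hooks_to_partitionK ?gaps_sorted //;
  [exact: sub_stable_gaps_down | exact: sub_stable_gaps_up].
Qed.

End DyckSubset.

Lemma leq_level P Q p : P \in dyck_subsets -> Q \in dyck_subsets ->
  {subset gaps P <= gaps Q} -> level P p <= level Q p.
Proof.
move=> dyck_P dyck_Q sub_PQ; rewrite leqNgt; apply/negP => lt_QP.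
have index_p := dvdn_level dyck_Q p.
have /sub_PQ : level Q p \in gaps P by rewrite (mem_gaps dyck_P index_p).
by rewrite (mem_gaps dyck_Q index_p) ltnn.
Qed.

Lemma level_inj P Q : P \in dyck_subsets -> Q \in dyck_subsets ->
  level P =1 level Q -> P = Q.
Proof.
move=> dyck_P dyck_Q eq_level; have eq_ups p : ups P p = ups Q p.
  apply/eqP; rewrite -(eqn_pmul2l (ltn0Sn n)).
  by rewrite -(levelK dyck_P) -(levelK dyck_Q) eq_level.
apply/setP => i; have := eq_ups i.+1; rewrite !upsS eq_ups valZpK => /addnI.
by case: (i \in P); case: (i \in Q).
Qed.

Lemma core_of_inj : {in dyck_subsets &, injective core_of}.
Proof.
move=> P Q dyck_P dyck_Q /(congr1 first_column_hooks).
rewrite !hooks_to_partitionK ?gaps_sorted // => eq_gaps.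
apply: level_inj => // p; apply/eqP.
by rewrite eqn_leq !leq_level // => b; rewrite eq_gaps.
Qed.

Section WalkOfHooks.

Variables (t : nat) (B : seq nat).
Hypothesis st_n : s + t = n.+1.
Hypothesis zero_notin : 0 \notin B.
Hypothesis stable_s : sub_stable s B.
Hypothesis stable_t : sub_stable t B.

Lemma sub_stable_muln k : sub_stable (k * n.+1) B.
Proof.
elim: k => [|k IH] b b_in le_b; first by rewrite subn0.
have -> : b - k.+1 * n.+1 = b - k * n.+1 - s - t by lia.
by apply: stable_t; [apply: stable_s; [apply: IH|]|]; lia.
Qed.

Lemma exists_nonhook p : exists x, (n.+1 %| x + s * p) && (x \notin B).
Proof.
have [m index_m] := exists_index (s * p).
pose bound := \max_(b <- B) b.+1; exists (s * m + n.+1 * bound).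
apply/andP; split.
  by rewrite addnAC dvdn_addl ?dvdn_mulr // addnC.
apply/negP => in_B.
have : s * m + n.+1 * bound < bound.
  exact: (@leq_bigmax_seq _ B xpredT succn _ in_B isT).
by rewrite ltnNge mulSn addnCA leq_addr.
Qed.

Definition least_nonhook p : nat := ex_minn (exists_nonhook p).

Lemma dvdn_least_nonhook p : n.+1 %| least_nonhook p + s * p.
Proof. by rewrite /least_nonhook; case: ex_minnP => x /andP[]. Qed.

Lemma least_nonhook_notin p : least_nonhook p \notin B.
Proof. by rewrite /least_nonhook; case: ex_minnP => x /andP[]. Qed.

Lemma least_nonhook_le p y :
  n.+1 %| y + s * p -> y \notin B -> least_nonhook p <= y.
Proof.
move=> index_p y_notin; rewrite /least_nonhook; case: ex_minnP => x _.
by apply; rewrite index_p.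
Qed.

Lemma least_nonhook0 : least_nonhook 0 = 0.
Proof. by apply/eqP; rewrite -leqn0 least_nonhook_le // muln0. Qed.

Lemma least_nonhook_mod p : least_nonhook (p %% n.+1) = least_nonhook p.
Proof.
apply: eq_ex_minn => x.
by rewrite /dvdn -modnDmr modnMmr modnDmr.
Qed.

Lemma mem_least_nonhook b p :
  n.+1 %| b + s * p -> (b \in B) = (b < least_nonhook p).
Proof.
move=> index_p; apply/idP/idP => [b_in|]; last first.
  by apply: contraTT => /(least_nonhook_le index_p); rewrite -leqNgt.
rewrite ltnNge; apply/negP => le_b; move/negP: (least_nonhook_notin p); apply.
have /dvdnP[k b_eq] : n.+1 %| b - least_nonhook p.
  by rewrite -(subnDr (s * p)) dvdn_sub // dvdn_least_nonhook.
have -> : least_nonhook p = b - k * n.+1 by rewrite -b_eq subKn.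
by apply: sub_stable_muln; rewrite // -b_eq leq_subr.
Qed.

Lemma least_nonhookS p :
  least_nonhook p.+1 = least_nonhook p + t \/
  least_nonhook p.+1 + s = least_nonhook p.
Proof.
have le_up : least_nonhook p.+1 <= least_nonhook p + t.
  apply: least_nonhook_le.
    rewrite mulnSr addnACA [t + s]addnC st_n.
    by rewrite dvdn_addl // dvdn_least_nonhook.
  apply: contra (least_nonhook_notin p) => /stable_t.
  by rewrite leq_addl addnK; apply.
have le_down : least_nonhook p <= least_nonhook p.+1 + s.
  apply: least_nonhook_le; first by rewrite -addnA -mulnS dvdn_least_nonhook.
  apply: contra (least_nonhook_notin p.+1) => /stable_s.
  by rewrite leq_addl addnK; apply.
have : n.+1 %| (least_nonhook p + s * p + n.+1) - (least_nonhook p.+1 + s * p.+1).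
  by rewrite dvdn_sub ?dvdn_least_nonhook // dvdn_addl // dvdn_least_nonhook.
have -> : least_nonhook p + s * p + n.+1 - (least_nonhook p.+1 + s * p.+1) =
    least_nonhook p + t - least_nonhook p.+1 by lia.
by case/dvdnP => -[|[|k]] diff_eq; [left | right | right]; nia.
Qed.

Definition up_steps : {set 'I_n.+1} :=
  [set i : 'I_n.+1 | least_nonhook i.+1 == least_nonhook i + t].

Lemma ups_up_steps p : n.+1 * ups up_steps p = least_nonhook p + s * p.
Proof.
have mem_up q : (inZp q \in up_steps) = (least_nonhook q.+1 == least_nonhook q + t).
  by rewrite inE /= -least_nonhook_mod -addn1 modnDml addn1 !least_nonhook_mod.
elim: p => [|p IH]; first by rewrite ups0 least_nonhook0 !muln0.
rewrite upsS mulnDr IH mem_up mulnS.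
by case: (least_nonhookS p) => step; case: eqP; lia.
Qed.

Lemma dyck_up_steps : up_steps \in dyck_subsets.
Proof.
apply/dyck_subsetsP; split=> [|p]; last by rewrite ups_up_steps leq_addl.
apply/eqP; rewrite -ups_period -(eqn_pmul2l (ltn0Sn n)) ups_up_steps.
by rewrite -least_nonhook_mod modnn least_nonhook0 add0n mulnC.
Qed.

Lemma gaps_up_steps : gaps up_steps =i B.
Proof.
move=> b; have [p index_p] := exists_index b.
rewrite (mem_gaps dyck_up_steps index_p) (mem_least_nonhook index_p).
by rewrite /level ups_up_steps addnK.
Qed.

End WalkOfHooks.

Lemma st_core_is_core_of t l : 0 < s -> 0 < t -> s + t = n.+1 ->
  st_core_partition s t l -> exists2 P, P \in dyck_subsets & l = core_of P.
Proof.
move=> s_gt0 t_gt0 st_n [/andP[sorted_l pos_l]].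
move=> /(is_core_sub_stable s_gt0 sorted_l) stable_s.
move=> /(is_core_sub_stable t_gt0 sorted_l) stable_t.
have zero_notin : 0 \notin first_column_hooks l.
  by apply/negP => /(allP (first_column_hooks_gt0 pos_l)).
exists (up_steps t (first_column_hooks l)); first exact: dyck_up_steps.
rewrite -[LHS]first_column_hooksK /core_of; congr hooks_to_partition.
apply: (irr_sorted_eq (rev_trans ltn_trans)) (gaps_sorted _) _.
- exact: ltnn.
- exact: first_column_hooks_sorted.
- by move=> b; rewrite gaps_up_steps.
Qed.

End CyclicWalk.

(** * The size of a core in terms of its up-steps *)

Local Open Scope ring_scope.

Section PowerSums.

Variable R : numFieldType.
Implicit Types (i m : nat).

Lemma sum_natr m : \sum_(0 <= p < m) p%:R = m%:R * (m%:R - 1) / 2 :> R.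
Proof.
elim: m => [|m IH]; first by rewrite big_geq // !mul0r.
by rewrite big_nat_recr //= IH -natr1; field.
Qed.

Lemma sum_natrX2 m :
  \sum_(0 <= p < m) p%:R ^+ 2 = m%:R * (m%:R - 1) * (2 * m%:R - 1) / 6 :> R.
Proof.
elim: m => [|m IH]; first by rewrite big_geq // !mul0r.
by rewrite big_nat_recr //= IH -natr1; field.
Qed.

Lemma sum_natrX3 m :
  \sum_(0 <= p < m) p%:R ^+ 3 = m%:R ^+ 2 * (m%:R - 1) ^+ 2 / 4 :> R.
Proof.
elim: m => [|m IH]; first by rewrite big_geq // expr0n !mul0r.
by rewrite big_nat_recr //= IH -natr1; field.
Qed.

Lemma sum_natrX4 m :
  \sum_(0 <= p < m) p%:R ^+ 4 =
  m%:R * (m%:R - 1) * (2 * m%:R - 1) * (3 * m%:R ^+ 2 - 3 * m%:R - 1) / 30 :> R.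
Proof.
elim: m => [|m IH]; first by rewrite big_geq // !mul0r.
by rewrite big_nat_recr //= IH -natr1; field.
Qed.

Lemma sum_natr_gt i m (F : nat -> R) : (i < m)%N ->
  \sum_(0 <= p < m) (i < p)%:R * F p =
  \sum_(0 <= p < m) F p - \sum_(0 <= p < i.+1) F p.
Proof.
move=> lt_im; rewrite [X in _ = X - _](big_cat_nat _ lt_im) //= addrAC subrr add0r.
rewrite (big_nat_widenl i.+1 0%N) // [RHS]big_mkcond /=; apply: eq_bigr => p _.
by case: ifP; rewrite ?mul1r ?mul0r.
Qed.

Lemma natr_bin2 m : 'C(m, 2)%:R = m%:R * (m%:R - 1) / 2 :> R.
Proof. by rewrite -bin2_sum natr_sum sum_natr. Qed.

End PowerSums.

Lemma telescope_sum_modn (V : zmodType) (N : nat) (F G : nat -> V) (x : nat) :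
  (0 < N)%N -> (forall y, G (y + N)%N - G y = F y) ->
  \sum_(0 <= b < x | b == x %[mod N]) F b = G x - G (x %% N)%N.
Proof.
move=> N_gt0 diff_G; elim/ltn_ind: x => x IH.
have [lt_xN|le_Nx] := ltnP x N.
  rewrite [in RHS]modn_small // subrr big_nat_cond big1 // => b.
  move=> /andP[/andP[_ lt_bx]].
  by rewrite !modn_small // ?(ltn_trans lt_bx) // => /eqP; lia.
pose y := (x - N)%N; have x_eq : x = (y + N)%N by rewrite subnK.
rewrite x_eq !modnDr (@big_cat_nat _ _ _ y) ?leq_addr //= IH; last by lia.
rewrite big_ltn_cond; last by lia.
rewrite eqxx big_nat_cond big1 ?addr0 => [|b].
  by rewrite -diff_G addrC addrA addrNK.
move=> /andP[/andP[lt_yb lt_b]]; rewrite eqn_mod_dvd; last exact: ltnW.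
by move=> /dvdn_leq; lia.
Qed.

Section ScaledCovariance.

Variables (R : comPzRingType) (T : finType).

(* This is [#|T| ^ 2] times the covariance for the uniform distribution on [T]. *)
Definition scaled_cov (x y : T -> R) : R :=
  #|T|%:R * (\sum_p x p * y p) - (\sum_p x p) * (\sum_p y p).

Lemma eq_scaled_cov (x x' y y' : T -> R) :
  x =1 x' -> y =1 y' -> scaled_cov x y = scaled_cov x' y'.
Proof.
move=> eq_x eq_y; rewrite /scaled_cov; congr (_ * _ - _ * _).
all: by apply: eq_bigr => p _; rewrite ?eq_x ?eq_y.
Qed.

Lemma scaled_covC (x y : T -> R) : scaled_cov x y = scaled_cov y x.
Proof.
rewrite /scaled_cov [X in _ - X]mulrC; congr (_ * _ - _).
by apply: eq_bigr => p _; rewrite mulrC.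
Qed.

Lemma scaled_cov_sum (I J : finType) (A : {pred I}) (B : {pred J})
    (x : I -> T -> R) (y : J -> T -> R) :
  scaled_cov (fun p => \sum_(i in A) x i p) (fun p => \sum_(j in B) y j p) =
  \sum_(i in A) \sum_(j in B) scaled_cov (x i) (y j).
Proof.
rewrite /scaled_cov; under [in LHS]eq_bigr do rewrite big_distrlr /=.
under [RHS]eq_bigr do rewrite sumrB -!mulr_sumr.
rewrite [RHS]sumrB -mulr_sumr; congr (_ * _ - _).
  by rewrite exchange_big; apply: eq_bigr => i _; rewrite exchange_big.
by rewrite exchange_big [X in _ * X]exchange_big mulr_suml.
Qed.

End ScaledCovariance.

Section Arc.

Variables (R : numFieldType) (n : nat).
Implicit Types (i j d : 'I_n.+1).

Local Notation N := (n.+1%:R : R).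

Definition arc d : R := d%:R * (N - d%:R).

Lemma arcN d : arc (- d) = arc d.
Proof.
rewrite /arc /=; have [->|d_neq0] := eqVneq (d : nat) 0%N.
  by rewrite subn0 modnn !mul0r.
rewrite modn_small; last by lia.
by rewrite natrB; [ring|exact: ltnW].
Qed.

Lemma arc_subC i j : arc (i - j) = arc (j - i).
Proof. by rewrite -arcN opprB. Qed.

Lemma arc_subrr i : arc (i - i) = 0.
Proof. by rewrite subrr /arc mul0r. Qed.

Lemma sum_arc_sub (F : R -> R) i : \sum_j F (arc (i - j)) = \sum_d F (arc d).
Proof. by rewrite [RHS](reindex_inj (@subrI _ i)). Qed.

Lemma arc_sub i j : (j <= i)%N ->
  arc (i - j) = (i%:R - j%:R) * (N - (i%:R - j%:R)).
Proof.
move=> le_ji; suff sub_nat : (i - j : 'I_n.+1) = (i - j)%N :> nat.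
  by rewrite /arc sub_nat natrB.
rewrite /= modnDmr addnBA; last exact: ltnW.
by rewrite addnC -addnBA // modnDl modn_small //; have := ltn_ord i; lia.
Qed.

Lemma sum_arc : \sum_d arc d = N * (N ^+ 2 - 1) / 6.
Proof.
rewrite -(big_mkord xpredT (fun d : nat => d%:R * (N - d%:R))).
under eq_bigr do rewrite mulrBr -expr2.
by rewrite sumrB -mulr_suml sum_natr sum_natrX2; field.
Qed.

Lemma sum_arc_sqr : \sum_d arc d ^+ 2 = N * (N ^+ 4 - 1) / 30.
Proof.
rewrite -(big_mkord xpredT (fun d : nat => (d%:R * (N - d%:R)) ^+ 2)).
transitivity (\sum_(0 <= d < n.+1)
    (d%:R ^+ 2 * N ^+ 2 - d%:R ^+ 3 * (2 * N) + d%:R ^+ 4)).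
  by apply: eq_bigr => d _; ring.
by rewrite big_split sumrB /= -!mulr_suml sum_natrX2 sum_natrX3 sum_natrX4; field.
Qed.

Definition centered_step i (p : 'I_n.+1) : R := N * (i < p)%:R - p%:R.

Lemma sum_centered_step i :
  \sum_p centered_step i p = N * ((N - 1) / 2 - i%:R).
Proof.
rewrite -(big_mkord xpredT (fun p : nat => N * (i < p)%:R - p%:R)) sumrB -mulr_sumr.
under eq_bigr do rewrite -[_%:R]mulr1.
by rewrite sum_natr_gt // !sumr_const_nat !subn0 sum_natr -[i.+1%:R]natr1; field.
Qed.

Lemma sum_centered_stepM i j : (i <= j)%N ->
  \sum_p centered_step i p * centered_step j p =
  N * (i%:R * (i%:R + 1) + j%:R * (j%:R + 1)) / 2 - N ^+ 2 * j%:R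
  + N * (N - 1) * (2 * N - 1) / 6.
Proof.
move=> le_ij; rewrite -(big_mkord xpredT
  (fun p : nat => (N * (i < p)%:R - p%:R) * (N * (j < p)%:R - p%:R))).
transitivity (\sum_(0 <= p < n.+1) (N ^+ 2 * ((j < p)%:R * 1)
   - N * ((i < p)%:R * p%:R + (j < p)%:R * p%:R) + p%:R ^+ 2)).
  apply: eq_bigr => p _.
  case: (ltnP j p) => [/(leq_ltn_trans le_ij) ->|_];
    by rewrite ?mulr1n ?mulr0n; ring.
rewrite big_split sumrB /= -!mulr_sumr big_split /= !sum_natr_gt //.
by rewrite !sumr_const_nat !subn0 !sum_natr sum_natrX2 -!natr1; field.
Qed.

Lemma scaled_cov_centered_step i j :
  scaled_cov (centered_step i) (centered_step j) =
  N ^+ 2 * (N ^+ 2 - 1) / 12 - N ^+ 2 / 2 * arc (i - j).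
Proof.
wlog le_ij : i j / (i <= j)%N => [ordered|].
  have [/ordered//|/ltnW/ordered swapped] := leqP i j.
  by rewrite scaled_covC swapped arc_subC.
rewrite /scaled_cov card_ord sum_centered_stepM // !sum_centered_step.
by rewrite arc_subC arc_sub //; field.
Qed.

End Arc.

Arguments arc {R n} d.

Definition pair_energy (R : nmodType) (T : finType) (w : T -> T -> R)
    (P : {set T}) : R :=
  \sum_(i in P) \sum_(j in P) w i j.

Definition arc_energy (R : numFieldType) (n : nat) (P : {set 'I_n.+1}) : R :=
  pair_energy (fun i j => arc (i - j)) P.

Arguments arc_energy {R n} P.

Section SizeFormula.

Variables (R : numFieldType) (s n : nat).
Hypothesis coprime_s_n : coprime s n.+1.
Variable P : {set 'I_n.+1}.
Hypothesis dyck_P : P \in dyck_subsets s n.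

Local Notation N := (n.+1%:R : R).
Local Notation lev p := ((level s P p)%:R : R).

Lemma sum_level_modn (V : nmodType) (F : nat -> V) :
  \sum_(p < n.+1) F (level s P p %% n.+1)%N = \sum_(0 <= i < n.+1) F i.
Proof.
have inj : injective (fun p : 'I_n.+1 => inZp (level s P p) : 'I_n.+1).
  move=> p q /(congr1 val) /= eq_level.
  exact: eq_ord_index eq_level (dvdn_level dyck_P p) (dvdn_level dyck_P q).
by rewrite big_mkord [RHS](reindex_inj inj).
Qed.

Lemma sum_gaps_level (V : nmodType) (F : nat -> V) :
  \sum_(b <- gaps s P) F b =
  \sum_(p < n.+1) \sum_(0 <= b < level s P p | b == level s P p %[mod n.+1]) F b.
Proof.
transitivity (\sum_(0 <= b < n.+1 * n.+1) \sum_(p < n.+1)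
   if (b < level s P p)%N && (n.+1 %| b + s * p)%N then F b else 0).
  rewrite /gaps (perm_big _ (permEl (perm_rev _))) big_filter big_mkcond.
  rewrite /index_iota subn0; apply: eq_bigr => b _.
  have [p index_p] := exists_index coprime_s_n b.
  have index_uniq (q : 'I_n.+1) : (n.+1 %| b + s * q)%N -> q = p.
    by move=> index_q; apply: eq_ord_index index_q index_p.
  rewrite (bigD1 p) //= index_p andbT big1 ?addr0 => [|q neq_qp]; last first.
    by case: ifP => // /andP[_ /index_uniq eq_qp]; rewrite eq_qp eqxx in neq_qp.
  congr (if _ then _ else _); apply/existsP/idP => [[q]|b_lt]; last first.
    by exists p; rewrite b_lt.
  by case/andP => b_lt /index_uniq <-.
rewrite exchange_big /=; apply: eq_bigr => p _.
have level_le_sqr : (level s P p <= n.+1 * n.+1)%N.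
  by apply: leq_trans (level_le s P p) _; rewrite leq_mul2l /= ltnW.
rewrite (big_nat_widen _ _ _ _ _ level_le_sqr) [RHS]big_mkcond /=.
apply: eq_bigr => b _; case: (ltnP b (level s P p)) => b_lt; last by rewrite andbF.
rewrite andbT /=; congr (if _ then _ else _).
rewrite eq_sym eqn_mod_dvd; last exact: ltnW.
rewrite -(subnDr (s * p)) dvdn_subr ?dvdn_level //.
by rewrite leq_add2r ltnW.
Qed.

Lemma sum_gaps (V : zmodType) (F G : nat -> V) :
  (forall y, G (y + n.+1)%N - G y = F y) ->
  \sum_(b <- gaps s P) F b =
  \sum_(p < n.+1) G (level s P p) - \sum_(0 <= i < n.+1) G i.
Proof.
move=> diff_G; rewrite sum_gaps_level -sum_level_modn -sumrB.
by apply: eq_bigr => p _; apply: telescope_sum_modn.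
Qed.

(* For gaps of numerical semigroups this is Selmer's formula, and the next one
   is due to Brown and Shiue. *)
Lemma size_gaps : (size (gaps s P))%:R = (\sum_(p < n.+1) lev p) / N - (N - 1) / 2.
Proof.
rewrite -sum1_size natr_sum (@sum_gaps _ _ (fun y : nat => y%:R / N)); last first.
  by move=> y; rewrite natrD; field; rewrite nat1r pnatr_eq0.
by rewrite -!mulr_suml sum_natr; field; rewrite nat1r pnatr_eq0.
Qed.

Lemma sumn_gaps :
  (sumn (gaps s P))%:R =
  (\sum_(p < n.+1) lev p ^+ 2) / (2 * N) - (\sum_(p < n.+1) lev p) / 2
  + (N ^+ 2 - 1) / 12.
Proof.
rewrite sumnE natr_sum.
rewrite (@sum_gaps _ _ (fun y : nat => y%:R ^+ 2 / (2 * N) - y%:R / 2)); last first.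
  by move=> y; rewrite natrD; field; rewrite nat1r pnatr_eq0.
rewrite !sumrB -!mulr_suml sum_natr sum_natrX2.
by field; rewrite nat1r pnatr_eq0.
Qed.

Lemma size_core_of_scaled_cov :
  (partition_size (core_of s P))%:R =
  scaled_cov (fun p : 'I_n.+1 => lev p) (fun p => lev p) / (2 * N ^+ 2)
  - (N ^+ 2 - 1) / 24.
Proof.
have := sumn_first_column_hooks (core_of s P).
rewrite hooks_to_partitionK ?gaps_sorted // size_hooks_to_partition.
move=> /(congr1 (fun m : nat => m%:R : R)); rewrite natrD natr_bin2.
rewrite sumn_gaps size_gaps => /eqP; rewrite -subr_eq => /eqP <-.
rewrite /scaled_cov card_ord; under [in RHS]eq_bigr do rewrite -expr2.
by field; rewrite nat1r pnatr_eq0.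
Qed.

Lemma natr_level (p : 'I_n.+1) : lev p = \sum_(i in P) centered_step R i p.
Proof.
rewrite sumrB sumr_const -mulr_sumr (card_dyck dyck_P) -mulrnA mulnC.
rewrite /level natrB ?dyck_ups // !natrM; congr (_ * _ - _).
rewrite /ups natr_sum big_mkord [RHS]big_mkcond /=.
rewrite (big_ord_widen n.+1 (fun q : nat => (inZp q \in P)%:R)); last exact: ltnW.
rewrite big_mkcond; apply: eq_bigr => i _.
by rewrite valZpK; case: ifP; case: ifP.
Qed.

Lemma scaled_cov_level :
  scaled_cov (fun p : 'I_n.+1 => lev p) (fun p => lev p) =
  s%:R ^+ 2 * (N ^+ 2 * (N ^+ 2 - 1) / 12) - N ^+ 2 / 2 * arc_energy P.
Proof.
have sum_const c : \sum_(i in P) c = s%:R * c :> R.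
  by rewrite sumr_const (card_dyck dyck_P) mulr_natl.
rewrite (eq_scaled_cov natr_level natr_level) scaled_cov_sum.
rewrite /arc_energy /pair_energy mulr_sumr expr2 -mulrA -!sum_const -sumrB.
apply: eq_bigr => i _; rewrite mulr_sumr -sumrB.
by apply: eq_bigr => j _; apply: scaled_cov_centered_step.
Qed.

Lemma size_core_of :
  (partition_size (core_of s P))%:R =
  (s%:R ^+ 2 - 1) * (N ^+ 2 - 1) / 24 - arc_energy P / 4.
Proof.
rewrite size_core_of_scaled_cov scaled_cov_level.
by field; rewrite nat1r pnatr_eq0.
Qed.

End SizeFormula.

(** * Rotations *)

Section Rotation.

Variables (s n : nat).
Implicit Types (r q : 'I_n.+1) (P : {set 'I_n.+1}).

Definition rotate r P := [set i | i + r \in P].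

Lemma rotate_inj r : injective (rotate r).
Proof.
move=> P Q /setP eq_PQ; apply/setP => i.
by have := eq_PQ (i - r); rewrite !inE subrK.
Qed.

Lemma card_rotate r P : #|rotate r P| = #|P|.
Proof. exact: (card_preimset P (@addIr _ r)). Qed.

Lemma arc_energy_rotate (R : numFieldType) r P :
  arc_energy (rotate r P) = arc_energy P :> R.
Proof.
rewrite /arc_energy /pair_energy [RHS](reindex_inj (@addIr _ r)).
apply: eq_big => i; first by rewrite inE.
move=> _; rewrite [RHS](reindex_inj (@addIr _ r)).
apply: eq_big => j; first by rewrite inE.
by rewrite opprD addrACA subrr addr0.
Qed.

Lemma ups_rotate r P (p : nat) :
  (ups (rotate r P) p + ups P r = ups P (p + r))%N.
Proof.
elim: p => [|p IH]; first by rewrite ups0.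
rewrite addSn !upsS -IH inE addnAC; congr (_ + (_ \in P))%N.
by apply/val_inj; rewrite /= modnDml.
Qed.

(* Starting at [r] keeps the walk nonnegative if and only if the walk of [P],
   whose height at [q] is [n.+1 * ups P q - s * q], is lowest at [r]. *)
Lemma dyck_rotateP r P : #|P| = s ->
  reflect (forall q, n.+1 * ups P r + s * q <= n.+1 * ups P q + s * r)%N
          (rotate r P \in dyck_subsets s n).
Proof.
move=> card_P; apply: (iffP (dyck_subsetsP _ _)) => [[_ nonneg] q|lowest].
  have le_rn := ltnW (ltn_ord r).
  have := nonneg (q + (n.+1 - r))%N; have := ups_rotate r P (q + (n.+1 - r)).
  by rewrite -addnA subnK // ups_add_period card_P; nia.
split=> [|p]; first by rewrite card_rotate.
have := lowest (inZp (p + r)); have := ups_rotate r P p.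
rewrite {1}(divn_eq (p + r) n.+1) [in X in _ = X]addnC ups_add_periods card_P /=.
by have := divn_eq (p + r) n.+1; move: (_ %/ _)%N (_ %% _)%N => k m; nia.
Qed.

Hypothesis coprime_s_n : coprime s n.+1.

(* The cycle lemma: the rotation has to start at the lowest level, and levels
   are pairwise incongruent modulo [n.+1]. *)
Lemma dyck_rotate_unique P : #|P| = s ->
  exists r, forall q, (rotate q P \in dyck_subsets s n) = (q == r).
Proof.
move=> card_P; pose height q := (n.+1 * ups P q + s * (n.+1 - q))%N.
case: (@arg_minnP _ (ord0 : 'I_n.+1) xpredT height isT) => r _ height_min.
have dyck_r : rotate r P \in dyck_subsets s n.
  apply/(dyck_rotateP _ card_P) => q; have := height_min q isT; rewrite /height.
  by have := ltn_ord q; have := ltn_ord r; nia.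
exists r => q; apply/idP/eqP => [dyck_q|-> //].
have height_eq : (n.+1 * ups P q + s * r = n.+1 * ups P r + s * q)%N.
  have lowest_r := elimT (dyck_rotateP _ card_P) dyck_r.
  have lowest_q := elimT (dyck_rotateP _ card_P) dyck_q.
  by apply/eqP; rewrite eqn_leq lowest_r lowest_q.
have eq_qr : q = r %[mod n.+1].
  apply: (eq_modn_coprimeMl coprime_s_n).
  rewrite -[in LHS](modnMDl (ups P r)) -[in RHS](modnMDl (ups P q)).
  by rewrite ![(_ * n.+1)%N]mulnC height_eq.
by apply/val_inj; move: eq_qr; rewrite !modn_small.
Qed.

Lemma sum_dyck_subsets (V : nmodType) (F : {set 'I_n.+1} -> V) :
  (forall r P, F (rotate r P) = F P) ->
  \sum_(P : {set 'I_n.+1} | #|P| == s) F P =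
  (\sum_(P in dyck_subsets s n) F P) *+ n.+1.
Proof.
move=> F_rotate.
transitivity (\sum_(P : {set 'I_n.+1} | #|P| == s) \sum_r
   if rotate r P \in dyck_subsets s n then F (rotate r P) else 0).
  apply: eq_bigr => P /eqP/dyck_rotate_unique[r dyck_r].
  by rewrite -big_mkcond (eq_bigl _ _ dyck_r) big_pred1_eq F_rotate.
rewrite exchange_big /= -[X in _ *+ X]card_ord -sumr_const; apply: eq_bigr => r _.
rewrite [RHS](reindex_inj (@rotate_inj r)) -big_mkcondr /=.
by apply: eq_bigl => P; rewrite inE card_rotate andbA andbb.
Qed.

End Rotation.

(** * Moments over random subsets *)

Lemma ffactD (n k m : nat) : (n ^_ (k + m) = n ^_ k * (n - k) ^_ m)%N.
Proof.
by elim: m => [|m IH]; rewrite ?addn0 ?muln1 // addnS !ffactnSr IH mulnA subnDA.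
Qed.

Lemma natr_ffactS (R : pzRingType) (m k : nat) :
  (m ^_ k.+1)%:R = (m ^_ k)%:R * (m%:R - k%:R) :> R.
Proof.
rewrite ffactnSr natrM; have [le_km|lt_mk] := leqP k m; first by rewrite natrB.
by rewrite ffact_small // !mul0r.
Qed.

Section Supersets.

Variables (T : finType) (s : nat).
Hypothesis le_s_T : (s <= #|T|)%N.

Lemma card_supersets (J : {set T}) :
  #|[set P : {set T} | J \subset P & #|P| == s]| = 'C(#|T| - #|J|, #|T| - s).
Proof.
have -> : (#|T| - #|J|)%N = #|~: J| by rewrite [RHS]cardsCs setCK.
have setC_inj : injective (@setC T) := inv_inj (@setCK T).
rewrite -cards_draws -(card_imset _ setC_inj).
apply: eq_card => P; rewrite -[P in LHS]setCK mem_imset //.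
rewrite !inE subsetC; congr (_ && _).
by rewrite [#|P|]cardsCs; have := max_card (~: P); lia.
Qed.

Lemma bin_supersets_ffact (m : nat) :
  ('C(#|T| - m, #|T| - s) * #|T| ^_ m = 'C(#|T|, s) * s ^_ m)%N.
Proof.
apply/eqP; rewrite -(eqn_pmul2r (fact_gt0 (#|T| - s))); apply/eqP.
rewrite mulnAC bin_ffact mulnC -ffactD addnC ffactD subKn //.
by rewrite -bin_ffact bin_sub // mulnAC.
Qed.

End Supersets.

Lemma sum_delta (R : pzSemiRingType) (T : finType) (i : T) (F : T -> R) :
  \sum_k (i == k)%:R * F k = F i.
Proof.
rewrite (bigD1 i) //= eqxx mul1r big1 ?addr0 // => k neq_ki.
by rewrite eq_sym (negPf neq_ki) mul0r.
Qed.

Lemma eq_both_neqF (T : eqType) (x y z : T) :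
  y != z -> (x == y) && (x == z) = false.
Proof. by move=> neq_yz; apply: contraNF neq_yz => /andP[/eqP <-]. Qed.

Lemma card_setU_pairs (T : finType) (i j k l : T) : i != j -> k != l ->
  (#|[set i; j] :|: [set k; l]|
     + ((i == k) + (i == l) + (j == k) + (j == l)) = 4)%N.
Proof.
move=> neq_ij neq_kl.
rewrite -setUA !cardsU1 cards1 !inE (negPf neq_ij) neq_kl !negb_or /=.
move: (eq_both_neqF i neq_kl) (eq_both_neqF j neq_kl).
by case: (i == k); case: (i == l); case: (j == k); case: (j == l).
Qed.

Section PairEnergyMoments.

Variables (R : comPzRingType) (T : finType) (s : nat) (w : T -> T -> R).
Hypothesis le_s_T : (s <= #|T|)%N.
Hypothesis wC : forall i j, w i j = w j i.
Hypothesis w_diag : forall i, w i i = 0.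

Local Notation nb_supersets m := ('C(#|T| - m, #|T| - s)%:R : R).

Lemma sum_subset (J : {set T}) :
  \sum_(P : {set T} | #|P| == s) (J \subset P)%:R = nb_supersets #|J|.
Proof.
rewrite -natr_sum -big_mkcondr sum1dep_card -card_supersets //; congr (_%:R).
by apply: eq_card => P; rewrite !inE andbC.
Qed.

Lemma pair_energyE (P : {set T}) :
  pair_energy w P = \sum_e w e.1 e.2 * ([set e.1; e.2] \subset P)%:R.
Proof.
rewrite -(pair_bigA _ (fun i j => w i j * ([set i; j] \subset P)%:R)) /=.
rewrite /pair_energy big_mkcond; apply: eq_bigr => i _; case: ifP => i_in.
  rewrite big_mkcond; apply: eq_bigr => j _; rewrite subUset !sub1set i_in.
  by case: (j \in P); rewrite ?mulr1 ?mulr0.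
by rewrite big1 // => j _; rewrite subUset sub1set i_in mulr0.
Qed.

Lemma sum_pair_energy :
  \sum_(P : {set T} | #|P| == s) pair_energy w P =
  nb_supersets 2 * \sum_i \sum_j w i j.
Proof.
under eq_bigr do rewrite pair_energyE.
rewrite exchange_big pair_bigA mulr_sumr; apply: eq_bigr => -[i j] _ /=.
rewrite -mulr_sumr sum_subset mulrC; have [->|neq_ij] := eqVneq i j.
  by rewrite w_diag !mulr0.
by rewrite cards2 neq_ij.
Qed.

(* Newton interpolation in the number of coincidences between two pairs, which
   is at most 2 and equals 2 exactly when one of the last products is 1. *)
Lemma interp_card_setU_pairs (f : nat -> R) (i j k l : T) : i != j -> k != l ->
  f #|[set i; j] :|: [set k; l]| =
  f 4 + (f 3 - f 4) * ((i == k)%:R + (i == l)%:R + (j == k)%:R + (j == l)%:R)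
  + (f 2 - 2 * f 3 + f 4)
    * ((i == k)%:R * (j == l)%:R + (i == l)%:R * (j == k)%:R).
Proof.
move=> neq_ij neq_kl.
have /(canRL (addnK _)) -> := card_setU_pairs neq_ij neq_kl.
move: (eq_both_neqF k neq_ij) (eq_both_neqF l neq_ij).
rewrite ![k == _]eq_sym ![l == _]eq_sym.
move: (eq_both_neqF i neq_kl) (eq_both_neqF j neq_kl).
case: (i == k); case: (i == l); case: (j == k); case: (j == l) => //= _ _ _ _.
all: by rewrite /subn /=; ring.
Qed.

Lemma sum_pair_coincidence (i j : T) :
  \sum_k \sum_l w k l * ((i == k)%:R + (i == l)%:R + (j == k)%:R + (j == l)%:R) =
  2 * (\sum_k w i k + \sum_k w j k).
Proof.
have sum_fst a : \sum_k \sum_l w k l * (a == k)%:R = \sum_k w a k.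
  rewrite -[RHS](sum_delta a (fun k => \sum_l w k l)).
  by apply: eq_bigr => k _; rewrite -mulr_suml mulrC.
have sum_snd a : \sum_k \sum_l w k l * (a == l)%:R = \sum_k w a k.
  by rewrite exchange_big -sum_fst; do 2!apply: eq_bigr => ? _; rewrite wC.
under eq_bigr do under eq_bigr do rewrite !mulrDr.
under eq_bigr do rewrite !big_split /=.
by rewrite !big_split /= !sum_fst !sum_snd; ring.
Qed.

Lemma sum_pair_double_coincidence (i j : T) :
  \sum_k \sum_l w k l * ((i == k)%:R * (j == l)%:R + (i == l)%:R * (j == k)%:R) =
  2 * w i j.
Proof.
have sum_pair a b : \sum_k \sum_l w k l * ((a == k)%:R * (b == l)%:R) = w a b.
  rewrite -[RHS](sum_delta b (w a)) -[RHS](sum_delta a (fun k => \sum_l _ * w k l)).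
  by apply: eq_bigr => k _; rewrite mulr_sumr; apply: eq_bigr => l _; ring.
under eq_bigr do under eq_bigr do rewrite mulrDr [X in _ + _ * X]mulrC.
under eq_bigr do rewrite big_split /=.
by rewrite big_split /= !sum_pair [w j i]wC; ring.
Qed.

Lemma sum_pair_card_setU (f : nat -> R) (i j : T) : i != j ->
  \sum_k \sum_l w k l * f #|[set i; j] :|: [set k; l]| =
  f 4 * (\sum_k \sum_l w k l)
  + (f 3 - f 4) * (2 * (\sum_k w i k + \sum_k w j k))
  + (f 2 - 2 * f 3 + f 4) * (2 * w i j).
Proof.
move=> neq_ij; rewrite -sum_pair_coincidence -sum_pair_double_coincidence.
rewrite !pair_bigA !mulr_sumr -!big_split; apply: eq_bigr => -[k l] _ /=.
have [->|neq_kl] := eqVneq k l; first by rewrite w_diag !(mulr0, mul0r, addr0).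
by rewrite interp_card_setU_pairs //; ring.
Qed.

Lemma sum_pair_energy_sqrE :
  \sum_(P : {set T} | #|P| == s) pair_energy w P ^+ 2 =
  \sum_i \sum_j w i j *
    \sum_k \sum_l w k l * nb_supersets #|[set i; j] :|: [set k; l]|.
Proof.
under eq_bigr do rewrite pair_energyE expr2 big_distrlr /=.
rewrite pair_bigA exchange_big; apply: eq_bigr => -[i j] _ /=.
rewrite pair_bigA mulr_sumr exchange_big; apply: eq_bigr => -[k l] _ /=.
rewrite -sum_subset !mulr_sumr; apply: eq_bigr => P _.
by rewrite mulrACA -natrM mulnb -subUset mulrA.
Qed.

Lemma sum_pair_energy_sqr :
  \sum_(P : {set T} | #|P| == s) pair_energy w P ^+ 2 =
  nb_supersets 4 * (\sum_i \sum_j w i j) ^+ 2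
  + (nb_supersets 3 - nb_supersets 4) * (4 * \sum_i (\sum_j w i j) ^+ 2)
  + (nb_supersets 2 - 2 * nb_supersets 3 + nb_supersets 4)
    * (2 * \sum_i \sum_j w i j ^+ 2).
Proof.
pose c m := nb_supersets m; pose row i := \sum_j w i j.
have sum_fst : \sum_i \sum_j w i j * row i = \sum_i row i ^+ 2.
  by apply: eq_bigr => i _; rewrite -mulr_suml expr2.
have sum_snd : \sum_i \sum_j w i j * row j = \sum_i row i ^+ 2.
  by rewrite exchange_big -sum_fst; do 2!apply: eq_bigr => ? _; rewrite wC.
rewrite sum_pair_energy_sqrE -!/(c _).
transitivity (\sum_i \sum_j (w i j * (c 4 * \sum_i row i)
    + (w i j * row i + w i j * row j) * (2 * (c 3 - c 4))
    + w i j ^+ 2 * (2 * (c 2 - 2 * c 3 + c 4)))).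
  apply: eq_bigr => i _; apply: eq_bigr => j _.
  have [->|/(sum_pair_card_setU c) ->] := eqVneq i j; last by rewrite /row; ring.
  by rewrite w_diag; ring.
under eq_bigr do rewrite !big_split -!mulr_suml !big_split.
rewrite !big_split -!mulr_suml !big_split /= sum_fst sum_snd.
by rewrite -/(\sum_i row i); ring.
Qed.

End PairEnergyMoments.

Section ArcEnergyMoments.

Variables (R : numFieldType) (s n : nat).
Hypothesis le_s_n : (s <= n.+1)%N.

Local Notation N := (n.+1%:R : R).
Local Notation nb_supersets m := ('C(n.+1 - m, n.+1 - s)%:R : R).
Local Notation nb_subsets := ('C(n.+1, s)%:R : R).

Lemma nb_supersets_ffact (m : nat) :
  nb_supersets m * (n.+1 ^_ m)%:R = nb_subsets * (s ^_ m)%:R.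
Proof.
rewrite -!natrM; congr (_%:R).
by have := @bin_supersets_ffact 'I_n.+1 s; rewrite card_ord; apply.
Qed.

Lemma sum_const_ord (c : R) : \sum_(i < n.+1) c = N * c.
Proof. by rewrite sumr_const card_ord mulr_natl. Qed.

Lemma sum_arc_energy :
  \sum_(P : {set 'I_n.+1} | #|P| == s) arc_energy P =
  nb_subsets * (s%:R * (s%:R - 1) * N * (N + 1) / 6).
Proof.
rewrite /arc_energy sum_pair_energy ?card_ord //; last exact: arc_subrr.
under eq_bigr do rewrite (sum_arc_sub id) sum_arc.
transitivity (nb_supersets 2 * (n.+1 ^_ 2)%:R * (N * (N + 1) / 6)).
  by rewrite sum_const_ord !natr_ffactS ffactn0; field.
by rewrite nb_supersets_ffact !natr_ffactS ffactn0; field.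
Qed.

(* The coefficient of each [nb_supersets m] in [sum_pair_energy_sqr] is divisible
   by [n.+1 ^_ m] as a polynomial in [n.+1], so no case [n.+1 < 4] is special. *)
Lemma sum_arc_energy_sqr :
  \sum_(P : {set 'I_n.+1} | #|P| == s) arc_energy P ^+ 2 =
  nb_subsets * (N * (N + 1) *
    ((s ^_ 4)%:R * (5 * N ^+ 2 + 5 * N + 2) / 180
     + (s ^_ 3)%:R * (5 * N ^+ 2 + 4 * N + 3) / 45
     + (s ^_ 2)%:R * (N ^+ 2 + 1) / 15)).
Proof.
rewrite /arc_energy sum_pair_energy_sqr ?card_ord //;
  [|exact: arc_subC|exact: arc_subrr].
under eq_bigr do rewrite (sum_arc_sub id) sum_arc.
under [\sum_i (\sum_j arc (i - j)) ^+ 2]eq_bigr do rewrite (sum_arc_sub id) sum_arc.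
under [\sum_i \sum_j arc (i - j) ^+ 2]eq_bigr do
  rewrite (sum_arc_sub (fun x => x ^+ 2)) sum_arc_sqr.
transitivity (N * (N + 1) *
    (nb_supersets 4 * (n.+1 ^_ 4)%:R * (5 * N ^+ 2 + 5 * N + 2) / 180
     + nb_supersets 3 * (n.+1 ^_ 3)%:R * (5 * N ^+ 2 + 4 * N + 3) / 45
     + nb_supersets 2 * (n.+1 ^_ 2)%:R * (N ^+ 2 + 1) / 15)).
  by rewrite !sum_const_ord !natr_ffactS ffactn0; field.
by rewrite !nb_supersets_ffact; ring.
Qed.

End ArcEnergyMoments.

(** * The size of a random core *)

Section UniformExpectation.

Variables (T : choiceType) (C : {fset T}).
Implicit Types (X Y : T -> rat) (a b : rat).

Lemma eq_unif_expectation X Y :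
  X =1 Y -> unif_expectation C X = unif_expectation C Y.
Proof. by move=> eq_XY; congr (_ / _); apply: eq_bigr => x _. Qed.

Lemma unif_expectationD X Y :
  unif_expectation C (fun x => X x + Y x) =
  unif_expectation C X + unif_expectation C Y.
Proof. by rewrite /unif_expectation big_split mulrDl. Qed.

Lemma unif_expectationZ a X :
  unif_expectation C (fun x => a * X x) = a * unif_expectation C X.
Proof. by rewrite /unif_expectation -mulr_sumr mulrA. Qed.

Hypothesis C_neq0 : C != fset0%fset.

Lemma unif_expectation_cst a : unif_expectation C (fun=> a) = a.
Proof.
rewrite /unif_expectation big_const_seq count_predT iter_addr_0 -[a *+ _]mulr_natr.
by rewrite mulfK // pnatr_eq0 cardfs_eq0.
Qed.

Lemma unif_varianceE X :
  unif_variance C X =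
  unif_expectation C (fun x => X x ^+ 2) - unif_expectation C X ^+ 2.
Proof.
rewrite /unif_variance; set mean := unif_expectation C X.
transitivity
    (unif_expectation C (fun x => X x ^+ 2 + (- 2 * mean * X x + mean ^+ 2))).
  by apply: eq_unif_expectation => x; ring.
by rewrite !unif_expectationD unif_expectationZ unif_expectation_cst -/mean; ring.
Qed.

Lemma unif_variance_affine a b X :
  unif_variance C (fun x => a + b * X x) = b ^+ 2 * unif_variance C X.
Proof.
rewrite /unif_variance unif_expectationD unif_expectationZ unif_expectation_cst.
by rewrite -[RHS]unif_expectationZ; apply: eq_unif_expectation => x; ring.
Qed.

End UniformExpectation.

Lemma unif_expectation_imfset (T : finType) (U : choiceType) (D : {set T})
    (f : T -> U) (X : U -> rat) : {in D &, injective f} ->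
  unif_expectation [fset f x | x in D]%fset X = (\sum_(x in D) X (f x)) / #|D|%:R.
Proof.
move=> f_inj; rewrite /unif_expectation card_in_imfset //= big_imfset //=.
by rewrite big_enum cardE.
Qed.

Definition draws (T : finType) (s : nat) : {fset {set T}} :=
  [fset P | P in [set P : {set T} | #|P| == s]]%fset.

Lemma unif_expectation_draws (T : finType) (s : nat) (X : {set T} -> rat) :
  unif_expectation (draws T s) X =
  (\sum_(P : {set T} | #|P| == s) X P) / 'C(#|T|, s)%:R.
Proof.
rewrite unif_expectation_imfset ?card_draws; last by move=> P Q.
by congr (_ / _); apply: eq_bigl => P; rewrite inE.
Qed.

Lemma draws_neq0 (T : finType) (s : nat) : (s <= #|T|)%N -> draws T s != fset0%fset.
Proof.
move=> le_s_T; rewrite -cardfs_eq0 card_in_imfset /=; last by move=> P Q.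
by rewrite -cardE card_draws -lt0n bin_gt0.
Qed.

Lemma unif_variance_arc_energy (s n : nat) (N := n.+1%:R : rat) : (s <= n.+1)%N ->
  unif_variance (draws 'I_n.+1 s) arc_energy =
  s%:R * (s%:R - 1) * (N - s%:R) * (N - s%:R - 1) * N * (N + 1) / 90.
Proof.
move=> le_s_n; rewrite unif_varianceE ?draws_neq0 ?card_ord //.
rewrite !unif_expectation_draws card_ord sum_arc_energy // sum_arc_energy_sqr //.
have nb_subsets_neq0 : 'C(n.+1, s)%:R != 0 :> rat.
  by rewrite pnatr_eq0 -lt0n bin_gt0.
by rewrite ![_%:R * _ / _]mulrAC !divff // !mul1r !natr_ffactS ffactn0 -/N; field.
Qed.

Lemma unif_variance_eq_law (T U : choiceType) (C : {fset T}) (D : {fset U})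
    (X : T -> rat) (Y : U -> rat) :
  (forall F : rat -> rat,
     unif_expectation C (fun x => F (X x)) =
     unif_expectation D (fun y => F (Y y))) ->
  unif_variance C X = unif_variance D Y.
Proof.
move=> same_law; rewrite /unif_variance (same_law id).
exact: same_law (fun x => (x - unif_expectation D Y) ^+ 2).
Qed.

Definition st_cores (s n : nat) : {fset seq nat} :=
  [fset core_of s P | P in dyck_subsets s n]%fset.

Section RandomCore.

Variables (s n : nat).
Hypothesis le_s_n : (s <= n.+1)%N.
Hypothesis coprime_s_n : coprime s n.+1.

Lemma mem_st_cores (t : nat) (l : seq nat) :
  (0 < s)%N -> (0 < t)%N -> (s + t = n.+1)%N ->
  l \in st_cores s n <-> st_core_partition s t l.
Proof.
move=> s_gt0 t_gt0 st_n; split=> [/imfsetP[P /= dyck_P ->]|st_core_l].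
  exact: core_of_st_core st_n.
have [P dyck_P ->] := st_core_is_core_of coprime_s_n s_gt0 t_gt0 st_n st_core_l.
exact: in_imfset.
Qed.

Lemma natr_card_dyck_subsets :
  #|dyck_subsets s n|%:R = 'C(n.+1, s)%:R / n.+1%:R :> rat.
Proof.
apply: (canRL (mulfK _)); first by rewrite pnatr_eq0.
have := @sum_dyck_subsets _ _ coprime_s_n rat (fun=> 1) (fun _ _ => erefl).
rewrite [in RHS]sumr_const mulr_natr => <-.
by rewrite -[n.+1 in RHS]card_ord -card_draws -sum1dep_card natr_sum.
Qed.

Lemma st_cores_neq0 : st_cores s n != fset0%fset.
Proof.
rewrite -cardfs_eq0 card_in_imfset /=; last exact: core_of_inj.
rewrite -cardE -(pnatr_eq0 rat) natr_card_dyck_subsets mulf_neq0 //.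
  by rewrite pnatr_eq0 -lt0n bin_gt0.
by rewrite invr_neq0 // pnatr_eq0.
Qed.

Lemma unif_expectation_st_cores (F : rat -> rat) :
  unif_expectation (st_cores s n) (fun l => F (partition_size l)%:R) =
  unif_expectation (draws 'I_n.+1 s) (fun P =>
    F ((s%:R ^+ 2 - 1) * (n.+1%:R ^+ 2 - 1) / 24 + - 4^-1 * arc_energy P)).
Proof.
rewrite unif_expectation_imfset; last exact: core_of_inj.
rewrite unif_expectation_draws card_ord natr_card_dyck_subsets.
rewrite (sum_dyck_subsets coprime_s_n) => [|r P]; last by rewrite arc_energy_rotate.
rewrite invf_div mulrA mulr_natr; congr (_ *+ _ / _); apply: eq_bigr => P dyck_P.
by rewrite (size_core_of _ coprime_s_n dyck_P) mulNr [4^-1 * _]mulrC.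
Qed.

Lemma unif_variance_st_cores (N := n.+1%:R : rat) :
  unif_variance (st_cores s n) (fun l => (partition_size l)%:R) =
  s%:R * (s%:R - 1) * (N - s%:R) * (N - s%:R - 1) * N * (N + 1) / 1440.
Proof.
rewrite (unif_variance_eq_law unif_expectation_st_cores) unif_variance_affine.
  have coef_eq : (- 4^-1) ^+ 2 / 90 = 1440^-1 :> rat by apply/eqP; vm_compute.
  by rewrite (unif_variance_arc_energy le_s_n) mulrCA coef_eq.
by rewrite draws_neq0 ?card_ord.
Qed.

End RandomCore.

Local Open Scope fset_scope.

Theorem theorem2 (s t : nat) (hs : (0 < s)%N) (ht : (0 < t)%N)
    (hst : coprime s t) :
  exists C : {fset seq nat},
    [/\ forall l : seq nat, l \in C <-> st_core_partition s t l,
        C != fset0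
      & unif_variance C (fun l => (partition_size l)%:R) =
        1 / 1440%:R * s%:R * t%:R * (t%:R - 1) * (s%:R - 1)
          * (s%:R + t%:R + 1) * (s%:R + t%:R)].
Proof.
pose n := (s + t).-1; have st_n : (s + t = n.+1)%N by rewrite /n; lia.
have le_s_n : (s <= n.+1)%N by rewrite -st_n leq_addr.
have coprime_s_n : coprime s n.+1 by rewrite -st_n /coprime gcdnDl.
exists (st_cores s n); split.
- by move=> l; apply: mem_st_cores.
- exact: st_cores_neq0.
- rewrite (unif_variance_st_cores le_s_n coprime_s_n) -st_n natrD.
  by move: (1440%:R^-1) => c; ring.
Qed.
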